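(* Let $k$ be a commutative ring, let $\mathcal{T}$ be a strongly finitely generated $k$-linear triangulated category and let $H:\mathcal{T}^{\mathrm{op}}\to k\text{-Mod}$ be a ($k$-linear) cohomological functor. Then $H$ is locally finitely presented if and only if it is a direct summand of a representable functor.
   Context: $k\text{-Mod}$ is the category of all $k$-modules. A functor $H:\mathcal{T}^{\mathrm{op}}\to k\text{-Mod}$ is cohomological if for every distinguished triangle $X\to Y\to Z\to X[1]$ the sequence $H(Z)\to H(Y)\to H(X)$ is exact. For $C\in\mathcal{T}$, $h_C=\operatorname{Hom}_{\mathcal{T}}(-,C)$. $H$ is locally finitely generated if for every $X\in\mathcal{T}$ there are $D\in\mathcal{T}$ and a natural transformation $\alpha:h_D\to H$ such that $\alpha(X[i])$ is surjective for all $i\in\mathbb{Z}$. $H$ is locally finitely presented if it is locally finitely generated and, for every $E\in\mathcal{T}$, the kernel of any map $h_E\to H$ is locally finitely generated. For a subcategory (or object) $\mathcal{I}$ of $\mathcal{T}$, $\langle\mathcal{I}\rangle$ is the smallest full subcategory containing $\mathcal{I}$ and closed under finite direct sums, direct summands and shifts; $\mathcal{I}_1*\mathcal{I}_2$ is the full subcategory of objects $M$ for which there is a distinguished triangle $M_1\to M\to M_2\to M_1[1]$ with $M_i\in\mathcal{I}_i$; $\mathcal{I}_1\diamond\mathcal{I}_2=\langle\mathcal{I}_1*\mathcal{I}_2\rangle$; $\langle\mathcal{I}\rangle_0=0$ and $\langle\mathcal{I}\rangle_i=\langle\mathcal{I}\rangle_{i-1}\diamond\langle\mathcal{I}\rangle$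 for $i\ge1$. $\mathcal{T}$ is strongly finitely generated if there are $G\in\mathcal{T}$ and $d\in\mathbb{N}$ with $\mathcal{T}=\langle G\rangle_d$. *)

(* Defs.v *)
From HB Require Import structures.
From mathcomp Require Import all_boot all_order all_algebra.

Set Implicit Arguments.
Unset Strict Implicit.
Unset Printing Implicit Defensive.

Import GRing.Theory.
Local Open Scope ring_scope.

Reserved Notation "g \oc f" (at level 40, left associativity).

(* Base rings are [comPzRingType], so the zero ring is allowed. *)

(** * k-linear additive categories *)

Record linear_category (k : comPzRingType) := LinearCategory {
  obj :> Type;
  mor : obj -> obj -> lmodType k;
  hid : forall X, mor X X;
  hcomp : forall X Y Z, mor Y Z -> mor X Y -> mor X Z;
  hcomp_linear_l : forall X Y Z (f : mor X Y), linear (fun g : mor Y Z => hcomp g f);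
  hcomp_linear_r : forall X Y Z (g : mor Y Z), linear (fun f : mor X Y => hcomp g f);
  hcomp_idl : forall X Y (f : mor X Y), hcomp (hid Y) f = f;
  hcomp_idr : forall X Y (f : mor X Y), hcomp f (hid X) = f;
  hcomp_assoc : forall W X Y Z (h : mor Y Z) (g : mor X Y) (f : mor W X),
    hcomp h (hcomp g f) = hcomp (hcomp h g) f
}.

Arguments mor {k _} X Y.
Arguments hid {k _} X.
Arguments hcomp {k _ X Y Z} g f.
Notation "g \oc f" := (hcomp g f).

Section LinearCategory.
Variables (k : comPzRingType) (C : linear_category k).

Definition is_iso (X Y : C) (f : mor X Y) : Prop :=
  exists g : mor Y X, g \oc f = hid X /\ f \oc g = hid Y.

Definition is_zero (Z : C) : Prop :=
  (forall (X : C) (f : mor X Z), f = 0) /\ (forall (X : C) (f : mor Z X), f = 0).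

Definition is_direct_sum (X Y P : C) : Prop :=
  exists (i1 : mor X P) (i2 : mor Y P) (p1 : mor P X) (p2 : mor P Y),
    [/\ p1 \oc i1 = hid X, p2 \oc i2 = hid Y,
        p1 \oc i2 = 0, p2 \oc i1 = 0 & i1 \oc p1 + i2 \oc p2 = hid P].

Definition is_additive : Prop :=
  (exists Z : C, is_zero Z) /\ (forall X Y : C, exists P : C, is_direct_sum X Y P).

End LinearCategory.

Record linear_functor (k : comPzRingType) (C D : linear_category k) := LinearFunctor {
  fobj :> C -> D;
  fmap : forall X Y : C, mor X Y -> mor (fobj X) (fobj Y);
  fmap_linear : forall X Y, linear (@fmap X Y);
  fmap_id : forall X, fmap (hid X) = hid (fobj X);
  fmap_comp : forall X Y Z (g : mor Y Z) (f : mor X Y),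
    fmap (g \oc f) = fmap g \oc fmap f
}.

Arguments fmap {k C D} F {X Y} f : rename.

Definition composite_iso_id (k : comPzRingType) (C D : linear_category k)
    (F : linear_functor C D) (G : linear_functor D C) : Prop :=
  exists t : forall X : C, mor X (G (F X)),
    (forall X, is_iso (t X)) /\
    (forall (X Y : C) (f : mor X Y), t Y \oc f = fmap G (fmap F f) \oc t X).

Definition quasi_inverse (k : comPzRingType) (C D : linear_category k)
    (F : linear_functor C D) (G : linear_functor D C) : Prop :=
  composite_iso_id F G /\ composite_iso_id G F.

(** * k-linear triangulated categories *)

(* The shift is an autoequivalence, with a chosen quasi-inverse; it is not
   required to be a strict automorphism.  No equality of objects is imposed
   between X[i][j] and X[i+j].  The predicate
   [distinguished f g h] is about the triangle X -f-> Y -g-> Z -h-> X[1]. *)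
Record triangulated_category (k : comPzRingType) := TriangulatedCategory {
  tcat :> linear_category k;
  tcat_additive : is_additive tcat;
  shift : linear_functor tcat tcat;
  unshift : linear_functor tcat tcat;
  shift_equivalence : quasi_inverse shift unshift;
  distinguished : forall X Y Z : tcat,
    mor X Y -> mor Y Z -> mor Z (shift X) -> Prop;
  (* TR1 *)
  distinguished_iso : forall (X Y Z X' Y' Z' : tcat)
      (f : mor X Y) (g : mor Y Z) (h : mor Z (shift X))
      (f' : mor X' Y') (g' : mor Y' Z') (h' : mor Z' (shift X'))
      (a : mor X X') (b : mor Y Y') (c : mor Z Z'),
    is_iso a -> is_iso b -> is_iso c ->
    b \oc f = f' \oc a -> c \oc g = g' \oc b -> fmap shift a \oc h = h' \oc c ->
    distinguished f g h -> distinguished f' g' h';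
  distinguished_id : forall X Z : tcat, is_zero Z ->
    distinguished (hid X) (0 : mor X Z) (0 : mor Z (shift X));
  distinguished_cone : forall (X Y : tcat) (f : mor X Y),
    exists (Z : tcat) (g : mor Y Z) (h : mor Z (shift X)), distinguished f g h;
  (* TR2 *)
  distinguished_rotate : forall (X Y Z : tcat)
      (f : mor X Y) (g : mor Y Z) (h : mor Z (shift X)),
    distinguished f g h <-> distinguished g h (- fmap shift f);
  (* TR3 *)
  distinguished_morphism : forall (X Y Z X' Y' Z' : tcat)
      (f : mor X Y) (g : mor Y Z) (h : mor Z (shift X))
      (f' : mor X' Y') (g' : mor Y' Z') (h' : mor Z' (shift X'))
      (a : mor X X') (b : mor Y Y'),
    distinguished f g h -> distinguished f' g' h' -> b \oc f = f' \oc a ->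
    exists c : mor Z Z', c \oc g = g' \oc b /\ fmap shift a \oc h = h' \oc c;
  (* TR4, the octahedral axiom *)
  distinguished_octahedron : forall (X Y Z X' Y' Z' : tcat)
      (u : mor X Y) (j : mor Y Z') (p : mor Z' (shift X))
      (v : mor Y Z) (l : mor Z X') (i : mor X' (shift Y))
      (m : mor Z Y') (n : mor Y' (shift X)),
    distinguished u j p -> distinguished v l i -> distinguished (v \oc u) m n ->
    exists (f : mor Z' Y') (g : mor Y' X'),
      [/\ distinguished f g (fmap shift j \oc i),
          f \oc j = m \oc v, n \oc f = p, g \oc m = l
        & i \oc g = fmap shift u \oc n]
}.

Arguments shift {k T} : rename.
Arguments unshift {k T} : rename.
Arguments distinguished {k T X Y Z} f g h : rename.

Definition shiftn (k : comPzRingType) (T : triangulated_category k) (X : T)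
    (i : int) : T :=
  match i with
  | Posz n => iter n shift X
  | Negz n => iter n.+1 unshift X
  end.

(** * Generation *)

Section Generation.
Variables (k : comPzRingType) (T : triangulated_category k).

(* Full subcategories are given by predicates on objects. *)
Inductive shift_additive_closure (I : T -> Prop) : T -> Prop :=
  | sac_in X : I X -> shift_additive_closure I X
  | sac_zero X : is_zero X -> shift_additive_closure I X
  | sac_direct_sum X Y P : is_direct_sum X Y P ->
      shift_additive_closure I X -> shift_additive_closure I Y ->
      shift_additive_closure I P
  | sac_direct_summand X Y P : is_direct_sum X Y P ->
      shift_additive_closure I P -> shift_additive_closure I X
  | sac_shift X : shift_additive_closure I X -> shift_additive_closure I (shift X)
  | sac_unshift X : shift_additive_closure I X -> shift_additive_closure I (unshift X).

Definition star (I1 I2 : T -> Prop) (M : T) : Prop :=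
  exists (M1 M2 : T) (f : mor M1 M) (g : mor M M2) (h : mor M2 (shift M1)),
    [/\ I1 M1, I2 M2 & distinguished f g h].

Definition diamond (I1 I2 : T -> Prop) : T -> Prop :=
  shift_additive_closure (star I1 I2).

Fixpoint generated_in (I : T -> Prop) (d : nat) : T -> Prop :=
  match d with
  | 0 => @is_zero k T
  | d'.+1 => diamond (generated_in I d') (shift_additive_closure I)
  end.

Definition strongly_finitely_generated : Prop :=
  exists (G : T) (d : nat), forall X : T, generated_in (fun Y => Y = G) d X.

End Generation.

Arguments strongly_finitely_generated {k} T.

(** * k-linear functors C^op -> k-Mod *)

Record presheaf (k : comPzRingType) (C : linear_category k) := Presheaf {
  pobj :> C -> lmodType k;
  pfmap : forall X Y : C, mor X Y -> pobj Y -> pobj X;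
  pfmap_linear : forall X Y (f : mor X Y), linear (pfmap f);
  pfmap_linear_mor : forall X Y (x : pobj Y), linear (fun f : mor X Y => pfmap f x);
  pfmap_id : forall X (x : pobj X), pfmap (hid X) x = x;
  pfmap_comp : forall X Y Z (g : mor Y Z) (f : mor X Y) (x : pobj Z),
    pfmap (g \oc f) x = pfmap f (pfmap g x)
}.

Arguments pfmap {k C} H {X Y} f x : rename.

HB.instance Definition _ (k : comPzRingType) (C : linear_category k)
    (H : presheaf C) (X Y : C) (f : mor X Y) :=
  GRing.isLinear.Build k (H Y) (H X) *:%R (pfmap H f) (@pfmap_linear k C H X Y f).

Record nat_trans (k : comPzRingType) (C : linear_category k) (F G : presheaf C) :=
  NatTrans {
    nt_app :> forall X : C, {linear F X -> G X};
    nt_natural : forall (X Y : C) (f : mor X Y) (x : F Y),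
      nt_app X (pfmap F f x) = pfmap G f (nt_app Y x)
  }.

Definition is_nat_iso (k : comPzRingType) (C : linear_category k)
    (F G : presheaf C) (a : nat_trans F G) : Prop :=
  forall X : C, bijective (a X).

Definition yoneda (k : comPzRingType) (C : linear_category k) (A : C) : presheaf C :=
  @Presheaf k C (fun X => mor X A) (fun X Y f g => g \oc f)
    (fun X Y f => hcomp_linear_l f) (fun X Y g => hcomp_linear_r g)
    (fun X g => hcomp_idr g) (fun X Y Z g f h => hcomp_assoc h g f).

Section DirectSum.
Variables (k : comPzRingType) (C : linear_category k) (F G : presheaf C).

Definition psum_map (X Y : C) (f : mor X Y) (z : F Y * G Y) : F X * G X :=
  (pfmap F f z.1, pfmap G f z.2).

Fact psum_linear (X Y : C) (f : mor X Y) : linear (psum_map f).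
Proof. by move=> a u v; rewrite /psum_map /= !linearP. Qed.

Fact psum_linear_mor (X Y : C) (z : F Y * G Y) :
  linear (fun f : mor X Y => psum_map f z).
Proof. by move=> a f g; rewrite /psum_map !pfmap_linear_mor. Qed.

Fact psum_id (X : C) (z : F X * G X) : psum_map (hid X) z = z.
Proof. by case: z => x y; rewrite /psum_map !pfmap_id. Qed.

Fact psum_comp (X Y Z : C) (g : mor Y Z) (f : mor X Y) (z : F Z * G Z) :
  psum_map (g \oc f) z = psum_map f (psum_map g z).
Proof. by rewrite /psum_map !pfmap_comp. Qed.

Definition psum : presheaf C :=
  @Presheaf k C (fun X => (F X * G X)%type : lmodType k) psum_map
    psum_linear psum_linear_mor psum_id psum_comp.

End DirectSum.

Section KernelModule.
Variables (k : comPzRingType) (U V : lmodType k) (f : {linear U -> V}).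

Definition kermod_pred : {pred U} := fun u => f u == 0.

Fact kermod_submod_closed : submod_closed kermod_pred.
Proof.
split; first by rewrite unfold_in linear0.
by move=> a u v; rewrite !unfold_in linearP => /eqP-> /eqP->; rewrite scaler0 addr0.
Qed.

HB.instance Definition _ :=
  GRing.isSubmodClosed.Build k U kermod_pred kermod_submod_closed.

Record kermod := Kermod { kermod_val : U; kermod_valP : kermod_val \in kermod_pred }.

HB.instance Definition _ := [isSub for kermod_val].
HB.instance Definition _ := [Choice of kermod by <:].
HB.instance Definition _ := [SubChoice_isSubLmodule of kermod by <:].

End KernelModule.

Section Kernel.
Variables (k : comPzRingType) (C : linear_category k) (F G : presheaf C).
Variable a : nat_trans F G.

Fact pker_subproof (X Y : C) (f : mor X Y) (x : kermod (a Y)) :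
  pfmap F f (val x) \in kermod_pred (a X).
Proof.
by rewrite unfold_in nt_natural (eqP (kermod_valP x : a Y (val x) == 0)) linear0.
Qed.

Definition pker_map (X Y : C) (f : mor X Y) (x : kermod (a Y)) : kermod (a X) :=
  Kermod (pker_subproof f x).

Fact pker_linear (X Y : C) (f : mor X Y) : linear (pker_map f).
Proof. by move=> c u v; apply: val_inj; rewrite [RHS]linearP /= !linearP. Qed.

Fact pker_linear_mor (X Y : C) (x : kermod (a Y)) :
  linear (fun f : mor X Y => pker_map f x).
Proof. by move=> c f g; apply: val_inj; rewrite [RHS]linearP /= pfmap_linear_mor. Qed.

Fact pker_id (X : C) (x : kermod (a X)) : pker_map (hid X) x = x.
Proof. by apply: val_inj; rewrite /= pfmap_id. Qed.

Fact pker_comp (X Y Z : C) (g : mor Y Z) (f : mor X Y) (x : kermod (a Z)) :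
  pker_map (g \oc f) x = pker_map f (pker_map g x).
Proof. by apply: val_inj; rewrite /= pfmap_comp. Qed.

Definition pker : presheaf C :=
  @Presheaf k C (fun X => kermod (a X) : lmodType k) pker_map
    pker_linear pker_linear_mor pker_id pker_comp.

End Kernel.

Definition representable (k : comPzRingType) (C : linear_category k)
    (F : presheaf C) : Prop :=
  exists (A : C) (a : nat_trans (yoneda A) F), is_nat_iso a.

Definition is_direct_summand (k : comPzRingType) (C : linear_category k)
    (H F : presheaf C) : Prop :=
  exists (H' : presheaf C) (a : nat_trans (psum H H') F), is_nat_iso a.

Section Finiteness.
Variables (k : comPzRingType) (T : triangulated_category k).

Definition cohomological (H : presheaf T) : Prop :=
  forall (X Y Z : T) (f : mor X Y) (g : mor Y Z) (h : mor Z (shift X)),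
    distinguished f g h ->
    forall y : H Y, pfmap H f y = 0 <-> exists z : H Z, pfmap H g z = y.

Definition locally_finitely_generated (H : presheaf T) : Prop :=
  forall X : T, exists (D : T) (a : nat_trans (yoneda D) H),
    forall (i : int) (x : H (shiftn X i)), exists u, a (shiftn X i) u = x.

Definition locally_finitely_presented (H : presheaf T) : Prop :=
  locally_finitely_generated H /\
  forall (E : T) (b : nat_trans (yoneda E) H), locally_finitely_generated (pker b).

End Finiteness.

(* Main.v *)
From HB Require Import structures.
Require Import Defs.
From mathcomp Require Import all_boot all_order all_algebra.

Set Implicit Arguments.
Unset Strict Implicit.
Unset Printing Implicit Defensive.

Import GRing.Theory.
Local Open Scope ring_scope.

(** Write [h_A] for the functor represented by [A]. By the Yoneda lemma a map
    [h_A -> H] is an element [x] of [H A], and the kernel of the map consists of the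
    morphisms [f] with [pfmap H f x = 0].

    If [H] is a retract of [h_A], then [h_A -> H] is surjective, and the kernel of a
    map [h_E -> H] is that of the composite [h_E -> H -> h_A], a morphism [E -> A].
    Completing this morphism to a triangle [W -> E -> A -> W[1]] exhibits the kernel
    as a quotient of [h_W], so [H] is locally finitely presented ([retract_lfp]).

    Conversely let [H] be locally finitely presented and let [G] generate [T] in [d]
    steps. Start with [h_A -> H] surjective on all shifts of [G]. As the kernel is
    locally finitely generated, some [D -> A] has image the kernel on all shifts of
    [G]; since [H] is cohomological, [h_A -> H] extends along [A -> B], where [B] is the
    cone of [D -> A], and what [H] kills on the shifts of [G] dies in [B]
    ([approx_exists]). Iterate this construction. On an object built from [G] in
    finitely many steps, a diagram chase in the long exact sequences of a triangle
    shows that after [a] iterations the map to [H] is surjective, and that [b] further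
    iterations kill its kernel ([tame_star]). The numbers [a] and [b] depend only on how
    many steps were used to build the object ([tame_generated]), so by strong
    generation they serve for all objects at once. If [A] is reached after [a]
    iterations and [B] after [b] more, then [h_A -> h_B] factors through the quotient
    [H] of [h_A], and the factor [H -> h_B] is a section of [h_B -> H]
    ([lfp_retract]). Finally a retract of a functor to modules is a direct summand,
    with the kernel of the retraction as complement ([retract_direct_summand]). *)

(** * Linearity *)

Section LinearMaps.
Variables (k : comPzRingType) (U V : lmodType k) (f : U -> V).
Hypothesis lin_f : linear f.

Lemma linear_add u v : f (u + v) = f u + f v.
Proof. by have := lin_f 1 u v; rewrite !scale1r. Qed.

Lemma linear_zero : f 0 = 0.
Proof. by apply: (addrI (f 0)); rewrite -linear_add !addr0. Qed.

Lemma linear_opp u : f (- u) = - f u.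
Proof. by apply: (addrI (f u)); rewrite -linear_add !subrr linear_zero. Qed.

Lemma linear_sub u v : f (u - v) = f u - f v.
Proof. by rewrite linear_add linear_opp. Qed.

End LinearMaps.

Section Composition.
Variables (k : comPzRingType) (C : linear_category k).
Implicit Types X Y Z : C.

Lemma hcompDr X Y Z (g : mor Y Z) (f h : mor X Y) : g \oc (f + h) = g \oc f + g \oc h.
Proof. exact: (linear_add (hcomp_linear_r g)). Qed.

Lemma hcompBl X Y Z (g h : mor Y Z) (f : mor X Y) : (g - h) \oc f = g \oc f - h \oc f.
Proof. exact: (linear_sub (hcomp_linear_l f)). Qed.

Lemma hcompNl X Y Z (g : mor Y Z) (f : mor X Y) : (- g) \oc f = - (g \oc f).
Proof. exact: (linear_opp (hcomp_linear_l f)). Qed.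

Lemma hcompNr X Y Z (g : mor Y Z) (f : mor X Y) : g \oc (- f) = - (g \oc f).
Proof. exact: (linear_opp (hcomp_linear_r g)). Qed.

Lemma hcomp0l X Y Z (f : mor X Y) : (0 : mor Y Z) \oc f = 0.
Proof. exact: (linear_zero (hcomp_linear_l f)). Qed.

Lemma hcomp0r X Y Z (g : mor Y Z) : g \oc (0 : mor X Y) = 0.
Proof. exact: (linear_zero (hcomp_linear_r g)). Qed.

Lemma is_iso_id X : is_iso (hid X).
Proof. by exists (hid X); rewrite hcomp_idl. Qed.

Lemma is_iso_comp X Y Z (g : mor Y Z) (f : mor X Y) :
  is_iso g -> is_iso f -> is_iso (g \oc f).
Proof.
move=> [g' [g'g gg']] [f' [f'f ff']]; exists (f' \oc g'); split.
  by rewrite -hcomp_assoc (hcomp_assoc g') g'g hcomp_idl.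
by rewrite -hcomp_assoc (hcomp_assoc f) ff' hcomp_idl.
Qed.

Lemma is_iso_inv X Y (f : mor X Y) : is_iso f -> exists g : mor Y X, is_iso g.
Proof. by move=> [g [gf fg]]; exists g, f. Qed.

Lemma is_zero_id X : hid X = 0 -> is_zero X.
Proof.
by move=> id0; split=> Y f; [rewrite -(hcomp_idl f) | rewrite -(hcomp_idr f)];
  rewrite id0 ?hcomp0l ?hcomp0r.
Qed.

End Composition.

Section Functors.
Variables (k : comPzRingType) (C D : linear_category k) (F : linear_functor C D).

Lemma fmap0 X Y : fmap F (0 : mor X Y) = 0.
Proof. exact: (linear_zero (@fmap_linear _ _ _ F X Y)). Qed.

Lemma fmapD X Y (f g : mor X Y) : fmap F (f + g) = fmap F f + fmap F g.
Proof. exact: (linear_add (@fmap_linear _ _ _ F X Y)). Qed.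

Lemma fmap_iso X Y (f : mor X Y) : is_iso f -> is_iso (fmap F f).
Proof.
by move=> [g [gf fg]]; exists (fmap F g); rewrite -!fmap_comp gf fg !fmap_id.
Qed.

Lemma fmap_is_zero Z : is_zero Z -> is_zero (F Z).
Proof. by move=> [Z0 _]; apply: is_zero_id; rewrite -fmap_id (Z0 _ (hid Z)) fmap0. Qed.

Lemma fmap_direct_sum X Y P : is_direct_sum X Y P -> is_direct_sum (F X) (F Y) (F P).
Proof.
move=> [i1 [i2 [p1 [p2 [p1i1 p2i2 p1i2 p2i1 ip]]]]].
exists (fmap F i1), (fmap F i2), (fmap F p1), (fmap F p2).
by split; rewrite -!fmap_comp -?fmapD ?p1i1 ?p2i2 ?p1i2 ?p2i1 ?ip ?fmap_id ?fmap0.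
Qed.

End Functors.

Lemma retraction_faithful (k : comPzRingType) (C D : linear_category k)
    (F : linear_functor C D) (G : linear_functor D C) :
  composite_iso_id F G ->
  forall (X Y : C) (f g : mor X Y), fmap F f = fmap F g -> f = g.
Proof.
move=> [t [t_iso t_nat]] X Y f g Ffg.
have [t' [t't _]] := t_iso Y.
by rewrite -(hcomp_idl f) -(hcomp_idl g) -t't -!hcomp_assoc !t_nat Ffg.
Qed.

(** The candidate preimage of [b] is the conjugate of [G b] by the unit; it is
    the right one because [G] is itself faithful. *)
Lemma quasi_inverse_full (k : comPzRingType) (C D : linear_category k)
    (F : linear_functor C D) (G : linear_functor D C) :
  quasi_inverse F G ->
  forall (X Y : C) (b : mor (F X) (F Y)), exists f : mor X Y, fmap F f = b.
Proof.
move=> [[t [t_iso t_nat]] GF] X Y b.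
have [tX' [_ tX]] := t_iso X; have [tY' [_ tY]] := t_iso Y.
exists (tY' \oc fmap G b \oc t X).
apply: (retraction_faithful GF).
rewrite -[LHS]hcomp_idr -tX hcomp_assoc -t_nat.
by rewrite -!hcomp_assoc tX hcomp_idr hcomp_assoc tY hcomp_idl.
Qed.

(** * Presheaves *)

Section Presheaves.
Variables (k : comPzRingType) (C : linear_category k).
Implicit Types F G H K : presheaf C.

Lemma pfmapD H X Y (f g : mor X Y) (x : H Y) :
  pfmap H (f + g) x = pfmap H f x + pfmap H g x.
Proof. exact: (linear_add (pfmap_linear_mor x)). Qed.

Lemma pfmapB H X Y (f g : mor X Y) (x : H Y) :
  pfmap H (f - g) x = pfmap H f x - pfmap H g x.
Proof. exact: (linear_sub (pfmap_linear_mor x)). Qed.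

Lemma pfmap0 H X Y (x : H Y) : pfmap H (0 : mor X Y) x = 0.
Proof. exact: (linear_zero (pfmap_linear_mor x)). Qed.

Lemma presheaf_zero H X (x : H X) : is_zero X -> x = 0.
Proof. by move=> [X0 _]; rewrite -(pfmap_id x) (X0 _ (hid X)) pfmap0. Qed.

Definition mk_nat_trans F G (a : forall X : C, F X -> G X)
    (a_lin : forall X, linear (a X))
    (a_nat : forall (X Y : C) (f : mor X Y) (x : F Y),
      a X (pfmap F f x) = pfmap G f (a Y x)) : nat_trans F G :=
  @NatTrans k C F G
    (fun X => HB.pack (a X) (GRing.isLinear.Build k (F X) (G X) *:%R (a X) (a_lin X)))
    a_nat.

Definition yoneda_map H (A : C) (x : H A) : nat_trans (yoneda A) H :=
  @mk_nat_trans (yoneda A) H (fun X f => pfmap H f x)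
    (fun X => @pfmap_linear_mor k C H X A x)
    (fun X Y f g => pfmap_comp g f x).

Lemma yonedaE H (A X : C) (a : nat_trans (yoneda A) H) (f : mor X A) :
  a X f = pfmap H f (a A (hid A)).
Proof. by rewrite -nt_natural /= hcomp_idl. Qed.

Definition nat_id F : nat_trans F F :=
  @mk_nat_trans F F (fun X x => x) (fun X a u v => erefl) (fun X Y f x => erefl).

(** The universal property of a quotient of presheaves. The preimages under [p] come
    from the choice operator that every module carries; the result is natural and
    linear because two preimages of an element differ by one that [q] kills. *)
Lemma nat_trans_descend F G K (p : nat_trans F G) (q : nat_trans F K) :
  (forall X (y : G X), exists x, p X x = y) ->
  (forall X (x : F X), p X x = 0 -> q X x = 0) ->
  exists r : nat_trans G K, forall X (x : F X), r X (p X x) = q X x.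
Proof.
move=> p_surj pq.
have p_surj' X (y : G X) : exists x, p X x == y.
  by have [x <-] := p_surj X y; exists x.
pose lift X y := xchoose (p_surj' X y).
have liftK X y : p X (lift X y) = y by apply/eqP/(xchooseP (p_surj' X y)).
have q_eq X (x x' : F X) : p X x = p X x' -> q X x = q X x'.
  move=> e; apply/eqP; rewrite -subr_eq0 -linearB; apply/eqP/pq.
  by rewrite linearB e subrr.
have r_lin X : linear (fun y => q X (lift X y)).
  by move=> a u v; rewrite -linearP; apply: q_eq; rewrite linearP !liftK.
have r_nat X Y (f : mor X Y) y : q X (lift X (pfmap G f y)) = pfmap K f (q Y (lift Y y)).
  by rewrite -nt_natural; apply: q_eq; rewrite nt_natural !liftK.
by exists (mk_nat_trans r_lin r_nat) => X x; apply: q_eq; rewrite liftK.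
Qed.

Lemma nat_iso_inverse F G (a : nat_trans F G) : is_nat_iso a ->
  exists b : nat_trans G F,
    (forall X, cancel (a X) (b X)) /\ (forall X, cancel (b X) (a X)).
Proof.
move=> a_iso.
have a_surj X (y : G X) : exists x, a X x = y.
  by have [b _ bK] := a_iso X; exists (b y).
have a_inj X (x : F X) : a X x = 0 -> nat_id F X x = 0.
  by move=> ax0; apply: (bij_inj (a_iso X)); rewrite linear0 ax0.
have [b bE] := nat_trans_descend a_surj a_inj.
exists b; split=> X x; first exact: bE.
by have [z <-] := a_surj X x; rewrite bE.
Qed.

Definition retract H F : Prop :=
  exists (s : nat_trans H F) (p : nat_trans F H), forall X, cancel (s X) (p X).

(** The complement is the kernel of the retraction [p]; an element [y] splits as
    [s (p y)] plus the rest, which [p] kills. *)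
Lemma retract_direct_summand H F : retract H F -> is_direct_summand H F.
Proof.
move=> [s [p sK]].
pose c X (z : psum H (pker p) X) : F X := s X z.1 + val z.2.
have c_lin X : linear (@c X).
  by move=> a u v; rewrite /c /= !linearP /= scalerDr addrACA.
have c_nat X Y (f : mor X Y) z : c X (pfmap (psum H (pker p)) f z) = pfmap F f (c Y z).
  by rewrite /c /= nt_natural -linearD.
exists (pker p), (mk_nat_trans c_lin c_nat) => X.
have kerP (y : F X) : y - s X (p X y) \in kermod_pred (p X).
  by rewrite unfold_in linearB sK subrr.
exists (fun y => (p X y, Kermod (kerP y))) => [[x n]|y] /=; last first.
  by rewrite /c /= addrC subrK.
have pn : p X (val n) = 0 by apply/eqP/(valP n).
have pc : p X (c X (x, n)) = x by rewrite /c linearD pn sK addr0.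
by congr pair => //; apply: val_inj; rewrite /= pc /c addrC addKr.
Qed.

Lemma direct_summand_retract H F A :
  is_direct_summand H F -> forall a : nat_trans (yoneda A) F, is_nat_iso a ->
  retract H (yoneda A).
Proof.
move=> [H' [c c_iso]] a a_iso.
have [c' [cK c'K]] := nat_iso_inverse c_iso.
have [a' [aK a'K]] := nat_iso_inverse a_iso.
have s_lin X : linear (fun x : H X => a' X (c X (x, 0))).
  move=> l u v; rewrite -!linearP; congr (a' X (c X _)).
  by congr pair; rewrite /= scaler0 addr0.
have s_nat X Y (f : mor X Y) x :
    a' X (c X (pfmap H f x, 0)) = pfmap (yoneda A) f (a' Y (c Y (x, 0))).
  by rewrite -!nt_natural; congr (a' X (c X _)); rewrite /= /psum_map /= linear0.
have p_lin X : linear (fun f : yoneda A X => (c' X (a X f)).1).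
  by move=> l u v; rewrite !linearP.
have p_nat X Y (f : mor X Y) x :
    (c' X (a X (pfmap (yoneda A) f x))).1 = pfmap H f (c' Y (a Y x)).1.
  by rewrite !nt_natural.
exists (mk_nat_trans s_lin s_nat), (mk_nat_trans p_lin p_nat) => X x /=.
by rewrite a'K cK.
Qed.

End Presheaves.

(** * Triangles *)

Section Triangles.
Variables (k : comPzRingType) (T : triangulated_category k).
Implicit Types X Y Z A : T.

Lemma shift_full X Y (b : mor (shift X) (shift Y)) : exists f, fmap shift f = b.
Proof. exact: (quasi_inverse_full (@shift_equivalence k T)). Qed.

Lemma shift_faithful X Y (f g : mor X Y) : fmap shift f = fmap shift g -> f = g.
Proof. exact: (retraction_faithful (proj1 (@shift_equivalence k T))). Qed.

Lemma distinguished_comp0 X Y Z (f : mor X Y) (g : mor Y Z) (h : mor Z (shift X)) :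
  distinguished f g h -> g \oc f = 0.
Proof.
move=> fgh; have [[O O0] _] := tcat_additive T.
have e : f \oc hid X = f \oc hid X by [].
have [c [<- _]] := distinguished_morphism (distinguished_id X O0) fgh e.
by rewrite hcomp0r.
Qed.

(** Extend by zero the square with sides [y] and [0 -> A] to a morphism into the
    triangle 0 -> A = A -> 0; its third component is the factorization. *)
Lemma yoneda_cohomological A : cohomological (yoneda A).
Proof.
move=> X Y Z f g h fgh y; split=> [yf0|[z <-]]; last first.
  by rewrite /= -hcomp_assoc (distinguished_comp0 fgh) hcomp0r.
have [[O O0] _] := tcat_additive T.
have AA : distinguished (0 : mor O A) (hid A) (0 : mor A (shift O)).
  apply/distinguished_rotate; rewrite fmap0 oppr0.
  exact/distinguished_id/fmap_is_zero.
have e : y \oc f = 0 \oc (0 : mor X O) by rewrite hcomp0l.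
have [c [cg _]] := distinguished_morphism fgh AA e.
by exists c; rewrite /= cg hcomp_idl.
Qed.

(** Rotating backwards needs a morphism whose shift is the third side of the triangle,
    up to sign and the isomorphism of [Z] with [shift (unshift Z)]; the shift being
    full, there is one. *)
Lemma distinguished_unrotate X Y Z (f : mor X Y) (g : mor Y Z) (h : mor Z (shift X)) :
  distinguished f g h ->
  exists (e : mor (unshift Z) X) (i : mor Y (shift (unshift Z))), distinguished e f i.
Proof.
move=> fgh; have [_ [s [s_iso _]]] := @shift_equivalence k T.
have [s' [s's ss']] := s_iso Z.
have [e Se] := shift_full (- (h \oc s')).
exists e, (s Z \oc g); apply/distinguished_rotate; rewrite Se opprK.
apply: (distinguished_iso (is_iso_id X) (is_iso_id Y) (s_iso Z)) fgh.
- by rewrite hcomp_idl hcomp_idr.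
- by rewrite hcomp_idr.
- by rewrite fmap_id hcomp_idl -hcomp_assoc s's hcomp_idr.
Qed.

(** TR3 applied to the rotations of [V = V -> 0] and of the given triangle yields the
    factorization after one shift; it descends since the shift is fully faithful. *)
Lemma distinguished_weak_kernel V W X Y (e : mor W X) (f : mor X Y) (i : mor Y (shift W))
    (g : mor V X) :
  distinguished e f i -> f \oc g = 0 -> exists g', e \oc g' = g.
Proof.
move=> efi fg0; have [[O O0] _] := tcat_additive T.
have V1 := iffLR (distinguished_rotate _ _ _) (distinguished_id V O0).
have efi1 := iffLR (distinguished_rotate _ _ _) efi.
have sq : (0 : mor O Y) \oc (0 : mor V O) = f \oc g by rewrite fg0 hcomp0l.
have [c [_ cE]] := distinguished_morphism V1 efi1 sq.
have [g' Sg'] := shift_full c.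
exists g'; apply: shift_faithful; rewrite fmap_comp Sg'.
by apply: oppr_inj; rewrite -hcompNl -cE fmap_id hcompNr hcomp_idr.
Qed.

Lemma weak_kernel E A (f : mor E A) :
  exists (W : T) (e : mor W E), f \oc e = 0 /\
    forall V (g : mor V E), f \oc g = 0 -> exists g', e \oc g' = g.
Proof.
have [Z [g [h fgh]]] := distinguished_cone f.
have [e [i efi]] := distinguished_unrotate fgh.
exists (unshift Z), e; split=> [|V a]; first exact: distinguished_comp0 efi.
exact: distinguished_weak_kernel efi.
Qed.

(** * Iterated shifts *)

(** Iterated shifts are indexed by words in the shift and its quasi-inverse, because
    a word applied to [shift X] is again, on the nose, a word applied to [X]; the
    integer shifts satisfy this only up to isomorphism. *)
Definition shiftw (w : seq bool) X : T :=
  foldr (fun b Y => if b then shift Y else unshift Y) X w.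

Lemma shiftw_shift w X : shiftw w (shift X) = shiftw (rcons w true) X.
Proof. by rewrite /shiftw foldr_rcons. Qed.

Lemma shiftw_unshift w X : shiftw w (unshift X) = shiftw (rcons w false) X.
Proof. by rewrite /shiftw foldr_rcons. Qed.

Lemma shiftw_is_zero w X : is_zero X -> is_zero (shiftw w X).
Proof. by move=> X0; elim: w => //= -[] w; apply: fmap_is_zero. Qed.

Lemma shiftw_direct_sum w X Y P :
  is_direct_sum X Y P -> is_direct_sum (shiftw w X) (shiftw w Y) (shiftw w P).
Proof. by move=> XYP; elim: w => //= -[] w; apply: fmap_direct_sum. Qed.

(** Three rotations of a triangle, in either direction, give a triangle on the shifts
    of its vertices. *)
Lemma shiftw_distinguished w X Y Z (f : mor X Y) (g : mor Y Z) (h : mor Z (shift X)) :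
  distinguished f g h ->
  exists (f' : mor (shiftw w X) (shiftw w Y)) (g' : mor (shiftw w Y) (shiftw w Z))
    (h' : mor (shiftw w Z) (shift (shiftw w X))), distinguished f' g' h'.
Proof.
move=> fgh; elim: w => [|[] w [f' [g' [h' fgh']]]] /=; first by exists f, g, h.
  by do 3![move: fgh' => /distinguished_rotate fgh']; do 3!eexists; exact: fgh'.
have [e [i efi]] := distinguished_unrotate fgh'.
have [e1 [i1 efi1]] := distinguished_unrotate efi.
have [e2 [i2 efi2]] := distinguished_unrotate efi1.
by exists e2, e1, i2.
Qed.

Lemma shiftw_shiftn w X : exists (i : int) (f : mor (shiftw w X) (shiftn X i)), is_iso f.
Proof.
have [[t [t_iso _]] [s [s_iso _]]] := @shift_equivalence k T.
elim: w => [|b w [i [f f_iso]]] /=.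
  by exists 0, (hid X); exact: is_iso_id.
case: b; case: i f f_iso => n f f_iso.
- by exists (Posz n.+1), (fmap shift f); apply: fmap_iso.
- have [s' s'_iso] := is_iso_inv (s_iso (iter n unshift X)).
  have := is_iso_comp s'_iso (fmap_iso shift f_iso).
  move: (s' \oc _) => {s' s'_iso}; case: n f f_iso => [|n] f _ g g_iso.
    by exists 0, g.
  by exists (Negz n), g.
- case: n f f_iso => [|n] f f_iso.
    by exists (Negz 0), (fmap unshift f); apply: fmap_iso.
  have [t' t'_iso] := is_iso_inv (t_iso (iter n shift X)).
  by exists (Posz n), (t' \oc fmap unshift f); apply: is_iso_comp (fmap_iso _ _).
- by exists (Negz n.+1), (fmap unshift f); apply: fmap_iso.
Qed.

Lemma lfg_shiftw (H : presheaf T) X : locally_finitely_generated H ->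
  exists (D : T) (d : H D), forall w (x : H (shiftw w X)),
    exists f : mor (shiftw w X) D, pfmap H f d = x.
Proof.
move=> /(_ X) [D [a a_surj]]; exists D, (a D (hid D)) => w x.
have [i [f [g [gf _]]]] := shiftw_shiftn w X.
have [u uE] := a_surj i (pfmap H g x).
exists (u \oc f); rewrite pfmap_comp -yonedaE uE -pfmap_comp gf.
exact: pfmap_id.
Qed.

(** * Direct summands of representable functors *)

Lemma lfg_of_generator (H : presheaf T) A (x : H A) :
  (forall X (y : H X), exists f : mor X A, pfmap H f x = y) ->
  locally_finitely_generated H.
Proof. by move=> x_surj X; exists A, (yoneda_map x) => i y; exact: x_surj. Qed.

(** Composed with the inclusion of [H] in [h_A], a map [h_E -> H] keeps its kernel and
    becomes a morphism [E -> A], whose weak kernel generates. *)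
Lemma retract_lfp (H : presheaf T) A :
  retract H (yoneda A) -> locally_finitely_presented H.
Proof.
move=> [s [p sK]]; split.
  apply: (@lfg_of_generator H A (p A (hid A))) => X y.
  by exists (s X y); rewrite -yonedaE sK.
move=> E b; pose phi : mor E A := s E (b E (hid E)).
have sb X (f : mor X E) : s X (b X f) = phi \oc f by rewrite yonedaE nt_natural.
have bP X (f : mor X E) : b X f = 0 <-> phi \oc f = 0.
  rewrite -sb; split=> [->|sb0]; first by rewrite linear0.
  by apply: (can_inj (sK X)); rewrite sb0 linear0.
have [W [e [/bP/eqP phie eP]]] := weak_kernel phi.
apply: (@lfg_of_generator (pker b) W (Kermod phie)) => X [f f0].
have /eqP/bP/eP[g eg] := f0.
by exists g; apply: val_inj.
Qed.

(** * Approximation of a presheaf along a generator *)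

Section Approximation.
Variables (H : presheaf T) (G : T).

(** The two predicates say that [h_A -> H], the map given by [x], is surjective at [X],
    and that [u] annihilates its kernel at [X]. *)
Definition lifts X A (x : H A) : Prop :=
  forall y : H X, exists f : mor X A, pfmap H f x = y.

Definition kills X A B (x : H A) (u : mor A B) : Prop :=
  forall f : mor X A, pfmap H f x = 0 -> u \oc f = 0.

(** The towers of the construction, as a relation between their two ends: tracking the
    length alone makes it possible to cut a tower at any height without transporting
    morphisms along equalities of indices. *)
Inductive approx : nat -> forall A B : T, H A -> H B -> mor A B -> Prop :=
  | approx0 A (x : H A) : approx 0 x x (hid A)
  | approxS n A B C (x : H A) (y : H B) (z : H C) (u : mor A B) (v : mor B C) :
      approx n x y u -> pfmap H v z = y -> (forall w, kills (shiftw w G) y v) ->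
      approx n.+1 x z (v \oc u).

Lemma approx_pfmap n A B (x : H A) (y : H B) u : approx n x y u -> pfmap H u y = x.
Proof.
elim=> {n A B x y u} [A x|n A B C x y z u v _ ux vy _]; first exact: pfmap_id.
by rewrite pfmap_comp vy.
Qed.

Lemma approx_lifts X n A B (x : H A) (y : H B) u :
  approx n x y u -> lifts X x -> lifts X y.
Proof.
move=> xy x_lifts z; have [f fx] := x_lifts z.
by exists (u \oc f); rewrite pfmap_comp (approx_pfmap xy).
Qed.

Lemma approx_split m n A C (x : H A) (z : H C) u : approx (m + n) x z u ->
  exists B (y : H B) v w, [/\ approx m x y v, approx n y z w & u = w \oc v].
Proof.
move e: (m + n)%N => l xz; elim: xz m n e => {l A C x z u}
  [A x|l A B C x y z u v xy IH vz v_kills] m n e.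
  move: e => /eqP; rewrite addn_eq0 => /andP[/eqP-> /eqP->].
  by exists A, x, (hid A), (hid A); split; [exact: approx0..|rewrite hcomp_idl].
case: n e => [|n]; rewrite ?addn0 ?addnS.
  move=> ->; exists C, z, (v \oc u), (hid C).
  by split; [exact: approxS xy vz _|exact: approx0|rewrite hcomp_idl].
move=> [/IH[D [d [a [b [xd dy ->]]]]]].
by exists D, d, a, (v \oc b); split=> //; [exact: approxS dy vz _|rewrite hcomp_assoc].
Qed.

Lemma approx1_kills A B (x : H A) (y : H B) u :
  approx 1 x y u -> forall w, kills (shiftw w G) x u.
Proof.
move e: 1%N => n xy; case: xy e => // {}n A' B' C x' y' z u' v xy _ v_kills _ w f fx.
by rewrite -hcomp_assoc; apply: v_kills; rewrite pfmap_comp (approx_pfmap xy).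
Qed.

Hypothesis hH : cohomological H.

(** One step is the cone of a morphism [D -> A] that generates the kernel of
    [h_A -> H] on the shifts of [G]; the point [x] vanishes on [D], so it extends to the
    cone since [H] is cohomological. *)
Lemma approx_exists n A (x : H A) : locally_finitely_presented H ->
  exists B (y : H B) u, approx n x y u.
Proof.
move=> [_ lfp]; elim: n => [|n [B [y [u xy]]]].
  by exists A, x, (hid A); exact: approx0.
have [D [[e e0] eP]] := lfg_shiftw G (lfp B (yoneda_map y)).
have [C [v [h evh]]] := distinguished_cone e.
have [z vz] := iffLR (hH evh y) (eqP e0).
exists C, z, (v \oc u); apply: approxS xy vz _ => w f fy.
have f0 : f \in kermod_pred (yoneda_map y (shiftw w G)) by apply/eqP.
have [g /(congr1 val) /= <-] := eP w (Kermod f0).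
by rewrite hcomp_assoc (distinguished_comp0 evh) hcomp0l.
Qed.

(** The requirement is made for all words [w] at once because the step over a triangle
    [M1 -> M -> M2] uses it for [M1[1]] and [M2[-1]]. *)
Definition tame a b X : Prop :=
  forall w A (x : H A), (forall w', lifts (shiftw w' G) x) ->
    (forall B (y : H B) u, approx a x y u -> lifts (shiftw w X) y) /\
    (forall B (y : H B) u, approx b x y u -> kills (shiftw w X) x u).

Lemma tame_generator : tame 0 1 G.
Proof.
move=> w A x x_lifts; split=> B y u xy; first exact: approx_lifts xy _.
exact: approx1_kills xy w.
Qed.

Lemma tame_zero a b X : is_zero X -> tame a b X.
Proof.
move=> /shiftw_is_zero X0 w A x _; split=> B y u _.
  by move=> z; exists 0; rewrite pfmap0 [RHS]presheaf_zero.
by move=> f _; apply: (X0 w).2.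
Qed.

Lemma tame_closure a b (I : T -> Prop) : (forall X, I X -> tame a b X) ->
  forall X, shift_additive_closure I X -> tame a b X.
Proof.
move=> I_tame X; elim=> {X} [X|X|X Y P XYP _ tX _ tY|X Y P XYP _ tP|X _ tX|X _ tX].
- exact: I_tame.
- exact: tame_zero.
- move=> w A x xG.
  have [i1 [i2 [p1 [p2 [_ _ _ _ ip]]]]] := shiftw_direct_sum w XYP.
  have [lX kX] := tX w A x xG; have [lY kY] := tY w A x xG.
  split=> B y u xy.
    move=> z; have [f fy] := lX _ _ _ xy (pfmap H i1 z).
    have [g gy] := lY _ _ _ xy (pfmap H i2 z).
    exists (f \oc p1 + g \oc p2).
    by rewrite pfmapD !pfmap_comp fy gy -!pfmap_comp -pfmapD ip pfmap_id.
  move=> f fx; rewrite -(hcomp_idr f) -ip hcompDr hcompDr !(hcomp_assoc f).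
  rewrite (hcomp_assoc u _ p1) (hcomp_assoc u _ p2).
  by rewrite (kX _ _ _ xy) ?(kY _ _ _ xy) ?hcomp0l ?addr0 // pfmap_comp fx linear0.
- move=> w A x xG.
  have [i1 [i2 [p1 [p2 [pi _ _ _ _]]]]] := shiftw_direct_sum w XYP.
  have [lP kP] := tP w A x xG.
  split=> B y u xy.
    move=> z; have [f fy] := lP _ _ _ xy (pfmap H p1 z).
    by exists (f \oc i1); rewrite pfmap_comp fy -pfmap_comp pi pfmap_id.
  move=> f fx; rewrite -(hcomp_idr f) -pi (hcomp_assoc f) (hcomp_assoc u).
  by rewrite (kP _ _ _ xy) ?hcomp0l // pfmap_comp fx linear0.
- by move=> w; rewrite shiftw_shift; apply: tX.
- by move=> w; rewrite shiftw_unshift; apply: tX.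
Qed.

(** The chase for a triangle [M1 -> M -> M2].

    Surjectivity at [M]: for [c] in [H M], lift its restriction to [M1] after [a1]
    steps. The obstruction to extending the lift to [M] is a morphism from [M2[-1]] that
    vanishes in [H], so it disappears after [b2] steps. The extension differs from [c] by
    an element that comes from [H M2], which lifts after [a2] steps.

    Kernel at [M]: if [p : M -> A] vanishes in [H], its restriction to [M1] dies after
    [b1] steps, and then [p] factors through some [q] on [M2]. The class of [q] in [H M2]
    comes from [H (M1[1])]; it lifts after [a1] steps, and correcting [q] by the lift
    makes it vanish in [H] without changing its restriction to [M]. After [b2] more steps
    the corrected [q] is zero. *)
Lemma tame_star a1 b1 a2 b2 (I1 I2 : T -> Prop) M :
  (forall X, I1 X -> tame a1 b1 X) -> (forall X, I2 X -> tame a2 b2 X) ->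
  star I1 I2 M -> tame (a1 + b2 + a2) (b1 + a1 + b2) M.
Proof.
move=> t1 t2 [M1 [M2 [f0 [g0 [h0 [/t1 {}t1 /t2 {}t2 fgh0]]]]]] w A x xG.
have [f [g [h fgh]]] := shiftw_distinguished w fgh0.
split=> D z u.
  move=> /approx_split[C [y [u0 [u3 [xy yz _]]]]] c.
  have [B [x' [u1 [u2 [xx' x'y _]]]]] := approx_split xy.
  have x'G w' : lifts (shiftw w' G) x' by apply: approx_lifts xx' _.
  have yG w' : lifts (shiftw w' G) y by apply: approx_lifts x'y _.
  have [e [i efi]] := distinguished_unrotate fgh.
  have [p px'] := (t1 w A x xG).1 _ _ _ xx' (pfmap H f c).
  have u2pe : u2 \oc (p \oc e) = 0.
    have k2 : kills (unshift (shiftw w M2)) x' u2.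
      exact: (t2 (false :: w) B x' x'G).2 x'y.
    by apply: k2; rewrite pfmap_comp px' -pfmap_comp (distinguished_comp0 efi) pfmap0.
  have [q /= qf] : exists q, pfmap (yoneda C) f q = u2 \oc p.
    by apply/(yoneda_cohomological efi); rewrite /= -hcomp_assoc.
  have cq0 : pfmap H f (c - pfmap H q y) = 0.
    apply/eqP; rewrite linearB subr_eq0 /= -px' -(approx_pfmap x'y).
    by rewrite -!pfmap_comp qf.
  have [c2 c2g] := iffLR (hH fgh _) cq0.
  have [r rz] := (t2 w C y yG).1 _ _ _ yz c2.
  exists (u3 \oc q + r \oc g).
  by rewrite pfmapD !pfmap_comp (approx_pfmap yz) rz c2g addrC subrK.
move=> /approx_split[C [y [u0 [u3 [xy yz ->]]]]] p px.
have [B [x' [u1 [u2 [xx' x'y ->]]]]] := approx_split xy.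
have x'G w' : lifts (shiftw w' G) x' by apply: approx_lifts xx' _.
have yG w' : lifts (shiftw w' G) y by apply: approx_lifts x'y _.
have u1pf : u1 \oc p \oc f = 0.
  rewrite -hcomp_assoc; apply: (t1 w A x xG).2 xx' _ _.
  by rewrite pfmap_comp px linear0.
have [q /= qg] := iffLR (yoneda_cohomological fgh (u1 \oc p)) u1pf.
have qx' : pfmap H g (pfmap H q x') = 0.
  by rewrite -pfmap_comp qg pfmap_comp (approx_pfmap xx').
have ghf := iffLR (distinguished_rotate _ _ _) fgh.
have [c ch] := iffLR (hH ghf _) qx'.
have [r ry] := (t1 (true :: w) B x' x'G).1 _ _ _ x'y c.
have u3k : u3 \oc (u2 \oc q - r \oc h) = 0.
  apply: (t2 w C y yG).2 yz _ _.
  by rewrite pfmapB !pfmap_comp (approx_pfmap x'y) ry ch subrr.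
rewrite -!hcomp_assoc -qg (_ : u2 \oc _ = (u2 \oc q - r \oc h) \oc g).
  by rewrite hcomp_assoc u3k hcomp0l.
by rewrite hcompBl -!hcomp_assoc (distinguished_comp0 ghf) hcomp0r subr0.
Qed.

Lemma tame_generated d : exists a b, forall X,
  generated_in (fun Y => Y = G) d X -> tame a b X.
Proof.
elim: d => [|d [a [b IH]]]; first by exists 0, 0 => X; exact: tame_zero.
exists (a + 1 + 0)%N, (b + a + 1)%N; apply: tame_closure => X; apply: tame_star IH _.
by apply: tame_closure => Y ->; exact: tame_generator.
Qed.

End Approximation.

(** The section of [h_B -> H] is obtained by descending [h_A -> h_B] along
    [h_A -> H], where [A] is far enough for surjectivity and [B] far enough beyond [A]
    for the kernel to die. *)
Lemma lfp_retract (H : presheaf T) : strongly_finitely_generated T ->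
  cohomological H -> locally_finitely_presented H ->
  exists B, retract H (yoneda B).
Proof.
move=> [G [d Td]] hH lfp.
have [a [b tame_ab]] := tame_generated G hH d.
have [A0 [x0 x0G]] := lfg_shiftw G lfp.1.
have [A [x [u0 x0x]]] := approx_exists G hH a x0 lfp.
have xG w : lifts (shiftw w G) x by exact: approx_lifts x0x (x0G w).
have [B [y [u xy]]] := approx_exists G hH b x lfp.
have x_surj X (z : H X) : exists f, yoneda_map x X f = z.
  have [x_lifts _] := tame_ab X (Td X) [::] A0 x0 x0G.
  exact: x_lifts x0x z.
have u_kills X (f : yoneda A X) : yoneda_map x X f = 0 ->
    yoneda_map (u : yoneda B A) X f = 0.
  exact: (tame_ab X (Td X) [::] A x xG).2 xy _.
have [s sE] := nat_trans_descend x_surj u_kills.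
exists B, s, (yoneda_map y) => X z.
have [f <-] := x_surj X z.
by rewrite sE /= pfmap_comp (approx_pfmap xy).
Qed.

End Triangles.

Theorem theorem4p16 (k : comPzRingType) (T : triangulated_category k)
    (hT : strongly_finitely_generated T)
    (H : presheaf T) (hH : cohomological H) :
  locally_finitely_presented H <->
  exists F : presheaf T, representable F /\ is_direct_summand H F.
Proof.
split=> [lfp|[F [[A [a a_iso]] HF]]].
  have [B HB] := lfp_retract hT hH lfp.
  exists (yoneda B); split; last exact: retract_direct_summand.
  by exists B, (nat_id _) => X; exists id.
exact/retract_lfp/direct_summand_retract/a_iso.
Qed.
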